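(* The topology generated by the sets of marked groups that are semi-decidable from recursive presentations is the Scott topology on the lattice of marked groups. Precisely: on the set $\mathcal{G}_{RP}$ of recursively presented marked groups, the topology generated by the $\nu_{RP}$-semi-decidable subsets of $\mathcal{G}_{RP}$ coincides with the subspace topology induced by the Scott topology of the poset of all isomorphism classes of marked groups, ordered so that $(G,S)\le(H,S')$ if and only if $(H,S')$ is a marked quotient of $(G,S)$.
   Context: A $k$-marked group is a pair $(G,S)$ with $G$ a group and $S=(s_1,\dots,s_k)\in G^k$ a tuple generating $G$. A morphism $(G,S)\to(H,S')$ of $k$-marked groups is a group homomorphism sending $s_i$ to $s_i'$ for each $i$; marked groups are considered up to isomorphism of marked groups. $(H,S')$ is a marked quotient of $(G,S)$ if there is a morphism $(G,S)\to(H,S')$. Let $\mathcal{G}$ be the disjoint union over $k$ of the sets $\mathcal{G}_k$ of isomorphism classes of $k$-marked groups; groups marked by tuples of different lengths are incomparable. A subset $A$ of a poset $(L,\le)$ is Scott open if it is an upper set ($y\in A$, $y\le x$ imply $x\in A$) and is inaccessible by directed joins: whenever $D\subseteq L$ is a (nonempty) directed set with a supremum and $y\le\sup D$ for some $y\in A$, there is $x\in D$ with $y'\le x$ for some $y'\in A$ (equivalently, $\sup D\in A$ implies $D\cap A\neq\emptyset$). The Scott topology is the topology of Scott open sets. Let $\langle n,m\rangle$ be a computable bijection $\mathbb{N}^2\to\mathbb{N}$ with computable inverse, $\mathcal{A}_n=\{x_1,\dots,x_n\}$, $\theta_n:\mathbb{N}\to(\mathcal{A}_n\cup\mathcal{A}_n^{-1})^*$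 a natural computable bijection uniformly in $n\ge1$, $\varphi_0,\varphi_1,\dots$ a standard enumeration of the partial computable functions, $W_i=\mathrm{dom}(\varphi_i)$. The numbering of recursive presentations is $\nu_{RP}(\langle n,i\rangle)=\langle\mathcal{A}_n\mid\theta_n(W_i)\rangle$, marked by $(x_1,\dots,x_n)$; $\mathcal{G}_{RP}$ is its image. A subset $A\subseteq\mathcal{G}_{RP}$ is $\nu_{RP}$-semi-decidable if there is a partial computable function $F$ such that for all $p\in\mathrm{dom}(\nu_{RP})$, $F(p)$ is defined if and only if $\nu_{RP}(p)\in A$. *)

(* Defs.v *)
From HB Require Import structures.
From mathcomp Require Import all_boot all_order.
From mathcomp Require Import boolp classical_sets functions topology.

Set Implicit Arguments.
Unset Strict Implicit.
Unset Printing Implicit Defensive.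

Import Order.TTheory.

Local Open Scope classical_set_scope.
Local Open Scope group_scope.
Local Open Scope quotient_scope.

(* Arbitrary groups.  [groupType] is not used for the carrier of a marked group
   because [markedGroup] must itself be a [choiceType], hence live in a universe
   that is too small for it to contain a [groupType].  The universe of
   [group_sort] still contains nat and its subtypes, so that every finitely
   generated group, being countable, has an isomorphic copy there. *)
Record smallGroup := SmallGroup {
  group_sort :> Type;
  group_one : group_sort;
  group_inv : group_sort -> group_sort;
  group_mul : group_sort -> group_sort -> group_sort;
  group_mulA : associative group_mul;
  group_mul1g : left_id group_one group_mul;
  group_mulg1 : right_id group_one group_mul;
  group_mulVg : left_inverse group_one group_inv group_mul;
  group_mulgV : right_inverse group_one group_inv group_mul
}.

HB.instance Definition _ (G : smallGroup) := gen_eqMixin G.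
HB.instance Definition _ (G : smallGroup) := gen_choiceMixin G.
HB.instance Definition _ (G : smallGroup) := isGroup.Build G
  (@group_mulA G) (@group_mul1g G) (@group_mulg1 G)
  (@group_mulVg G) (@group_mulgV G).

(* The tuple (s_1, ..., s_k) is a sequence, k being its size: [markedGroup] is
   the disjoint union over k of the types of k-marked groups. *)
Record markedGroup := MarkedGroup {
  carrier :> smallGroup;
  marking : seq carrier;
  marking_generates : forall H : {pred carrier},
    group_closed H -> {subset marking <= H} -> forall x, x \in H
}.

(* This equation forces the two markings to have the same length. *)
Definition is_marked_morphism (X Y : markedGroup)
    (f : {multiplicative X -> Y}) : Prop :=
  map f (marking X) = marking Y.

Definition marked_quotient (X Y : markedGroup) : Prop :=
  exists f : {multiplicative X -> Y}, is_marked_morphism f.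

Definition marked_iso (X Y : markedGroup) : Prop :=
  exists2 f : {multiplicative X -> Y}, is_marked_morphism f & bijective f.

Lemma hom1 (G H : groupType) (f : {multiplicative G -> H}) : f 1 = 1.
Proof. by apply: (@mulgI _ (f 1)); rewrite -gmulfM !mulg1. Qed.

Lemma homF (G H : groupType) (f : {multiplicative G -> H}) x y :
  f (x / y) = f x / f y.
Proof. by apply: (@mulIg _ (f y)); rewrite -gmulfM !mulgVK. Qed.

Lemma marked_quotient_refl X : marked_quotient X X.
Proof. by exists idfun; apply: map_id. Qed.

Lemma marked_quotient_trans Y X Z :
  marked_quotient X Y -> marked_quotient Y Z -> marked_quotient X Z.
Proof.
move=> [f fXY] [g gYZ]; exists (g \o f).
by rewrite /is_marked_morphism map_comp fXY.
Qed.

Lemma marked_endomorphism_id (X : markedGroup) (f : {multiplicative X -> X}) :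
  is_marked_morphism f -> f =1 id.
Proof.
move=> fX x; apply/asboolP.
have := @marking_generates X [pred y | `[< f y = y >]]; apply; first split.
- exact/asboolP/hom1.
- by move=> u v /asboolP fu /asboolP fv; apply/asboolP; rewrite homF fu fv.
move=> s /(nthP 1)[i lti <-]; apply/asboolP.
by rewrite -(nth_map 1 1 f) // fX.
Qed.

Lemma marked_quotient_anti X Y :
  marked_quotient X Y -> marked_quotient Y X -> marked_iso X Y.
Proof.
move=> [f fXY] [g gYX]; exists f => //; exists g.
- apply: (@marked_endomorphism_id X (g \o f)).
  by rewrite /is_marked_morphism map_comp fXY.
- apply: (@marked_endomorphism_id Y (f \o g)).
  by rewrite /is_marked_morphism map_comp gYX.
Qed.

Lemma marked_iso_quotient X Y : marked_iso X Y -> marked_quotient X Y.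
Proof. by case=> f fXY _; exists f. Qed.

Lemma marked_iso_sym X Y : marked_iso X Y -> marked_iso Y X.
Proof.
move=> [f fXY [g fK gK]].
pose gm := isMultiplicative.Build Y X g (can2_gmulfM fK gK).
pose gmm : {multiplicative Y -> X} := HB.pack g gm.
apply: marked_quotient_anti; last by exists f.
by exists gmm; rewrite /is_marked_morphism -fXY mapK.
Qed.

HB.instance Definition _ := gen_eqMixin markedGroup.
HB.instance Definition _ := gen_choiceMixin markedGroup.

Definition marked_isob (X Y : markedGroup) : bool := `[< marked_iso X Y >].

Lemma marked_isob_refl : reflexive marked_isob.
Proof.
by move=> X; apply/asboolP/marked_quotient_anti; exact: marked_quotient_refl.
Qed.

Lemma marked_isob_sym : symmetric marked_isob.
Proof. by move=> X Y; apply: asbool_equiv_eq; split; exact: marked_iso_sym. Qed.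

Lemma marked_isob_trans : transitive marked_isob.
Proof.
move=> Y X Z /asboolP XY /asboolP YZ.
have [YX ZY] := (marked_iso_sym XY, marked_iso_sym YZ).
by apply/asboolP/marked_quotient_anti;
  apply: (@marked_quotient_trans Y); apply: marked_iso_quotient.
Qed.

Canonical marked_iso_equiv :=
  EquivRel marked_isob marked_isob_refl marked_isob_sym marked_isob_trans.

Definition markedClass : Type := {eq_quot marked_iso_equiv}.
HB.instance Definition _ := Choice.on markedClass.
HB.instance Definition _ := Quotient.on markedClass.

Definition marked_le (x y : markedClass) : bool :=
  `[< marked_quotient (repr x) (repr y) >].

Lemma marked_le_refl : reflexive marked_le.
Proof. by move=> x; apply/asboolP; exact: marked_quotient_refl. Qed.

Lemma marked_le_anti : antisymmetric marked_le.
Proof.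
move=> x y /andP[/asboolP xy /asboolP yx].
by rewrite -[x]reprK -[y]reprK; apply/eqmodP/asboolP/marked_quotient_anti.
Qed.

Lemma marked_le_trans : transitive marked_le.
Proof.
move=> y x z /asboolP xy /asboolP yz; apply/asboolP.
exact: marked_quotient_trans yz.
Qed.

Fact marked_display : Order.disp_t. Proof. exact: Order.Disp tt tt. Qed.

HB.instance Definition _ := Order.Le_isPOrder.Build marked_display markedClass
  marked_le_refl marked_le_anti marked_le_trans.

Section Scott.
Context {d : Order.disp_t} {T : porderType d}.

Definition directed (D : set T) : Prop :=
  D !=set0 /\
  forall x y, D x -> D y -> exists z, [/\ D z, (x <= z)%O & (y <= z)%O].

Definition scott_open : set (set T) := [set A |
  (forall x y : T, A y -> (y <= x)%O -> A x) /\
  (forall (D : set T) (s : T), directed D -> supremums D s -> A s ->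
     D `&` A !=set0)].

Lemma scott_openT : scott_open setT.
Proof. by split=> // D s [[x Dx] _] _ _; exists x. Qed.

Lemma scott_openI : setI_closed scott_open.
Proof.
move=> A B [upA inA] [upB inB]; split.
  by move=> x y [Ay By] yx; split; [exact: upA yx|exact: upB yx].
move=> D s dD sD [As Bs].
have [[x [Dx Ax]] [y [Dy By]]] := (inA D s dD sD As, inB D s dD sD Bs).
have [z [Dz xz yz]] := dD.2 x y Dx Dy.
by exists z; split=> //; split; [exact: upA xz|exact: upB yz].
Qed.

Lemma scott_open_bigU (I : Type) (f : I -> set T) :
  (forall i, scott_open (f i)) -> scott_open (\bigcup_i f i).
Proof.
move=> of_; split.
  by move=> x y [i _ fy] yx; exists i => //; exact: (of_ i).1 yx.
move=> D s dD sD [i _ fs]; have [x [Dx fx]] := (of_ i).2 D s dD sD fs.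
by exists x; split=> //; exists i.
Qed.

End Scott.

(* A copy of the poset [T], endowed with its Scott topology. *)
Definition scott {d : Order.disp_t} (T : porderType d) : Type := T.

HB.instance Definition _ d (T : porderType d) := Choice.on (scott T).
HB.instance Definition _ d (T : porderType d) :=
  isOpenTopological.Build (scott T) scott_openT scott_openI scott_open_bigU.

(* [(i, false)] stands for the letter x_(i+1), [(i, true)] for its inverse. *)
Definition letter (n : nat) : Type := ('I_n * bool)%type.
Definition word (n : nat) : Type := seq (letter n).
HB.instance Definition _ n := Countable.on (word n).

Definition inv_letter n (a : letter n) : letter n := (a.1, ~~ a.2).
Definition inv_word n (w : word n) : word n := rev (map (@inv_letter n) w).

Lemma inv_letterK n : involutive (@inv_letter n).
Proof. by case=> i b; rewrite /inv_letter /= negbK. Qed.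

Lemma inv_wordK n : involutive (@inv_word n).
Proof.
move=> w; rewrite /inv_word map_rev revK -map_comp -[RHS]map_id.
by apply: eq_map; exact: inv_letterK.
Qed.

(* The smallest congruence on words for which inverse letters cancel and the
   elements of [R] are trivial. *)
Inductive pres_eq n (R : set (word n)) : word n -> word n -> Prop :=
| pres_refl w : pres_eq R w w
| pres_sym u v : pres_eq R u v -> pres_eq R v u
| pres_trans u v w : pres_eq R u v -> pres_eq R v w -> pres_eq R u w
| pres_cat u u' v v' :
    pres_eq R u u' -> pres_eq R v v' -> pres_eq R (u ++ v) (u' ++ v')
| pres_cancel a : pres_eq R [:: a; inv_letter a] [::]
| pres_relator r : R r -> pres_eq R r [::].

Section Presentation.
Variables (n : nat) (R : set (word n)).

Lemma pres_invr w : pres_eq R (w ++ inv_word w) [::].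
Proof.
elim: w => [|a w IHw]; first exact: pres_refl.
rewrite /inv_word /= rev_cons -cats1 -cat_cons catA -/(inv_word w).
apply: (pres_trans (v := [:: a] ++ [::] ++ [:: inv_letter a]));
  last exact: pres_cancel.
rewrite -cat1s -!catA; apply: pres_cat; first exact: pres_refl.
by rewrite catA; apply: pres_cat; [exact: IHw|exact: pres_refl].
Qed.

Lemma pres_invl w : pres_eq R (inv_word w ++ w) [::].
Proof. by rewrite -{2}[w]inv_wordK; exact: pres_invr. Qed.

Lemma pres_inv u v : pres_eq R u v -> pres_eq R (inv_word u) (inv_word v).
Proof.
move=> uv; have rw := pres_refl R.
apply: (pres_trans (v := inv_word u ++ (v ++ inv_word v))).
  rewrite -{1}[inv_word u]cats0; apply: pres_cat (rw _) _.
  exact/pres_sym/pres_invr.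
apply: (pres_trans (v := (inv_word u ++ u) ++ inv_word v)).
  by rewrite catA; do 2?apply: pres_cat => //; exact: pres_sym.
rewrite -{2}[inv_word v]cat0s; apply: pres_cat => //; exact: pres_invl.
Qed.

Definition pres_eqb (u v : word n) : bool := `[< pres_eq R u v >].

Definition pres_canon (w : word n) : word n := choose (pres_eqb w) w.

Lemma pres_canon_eq w : pres_eq R w (pres_canon w).
Proof.
by apply/asboolP/(@chooseP _ (pres_eqb w)); apply/asboolP/pres_refl.
Qed.

Lemma pres_canonP u v : pres_canon u = pres_canon v <-> pres_eq R u v.
Proof.
split=> [uv|uv].
  apply: (pres_trans (pres_canon_eq u)).
  by rewrite uv; apply/pres_sym/pres_canon_eq.
have eq_uv : pres_eqb u =1 pres_eqb v.
  move=> w; apply: asbool_equiv_eq; split; last exact: pres_trans.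
  exact/pres_trans/pres_sym.
rewrite /pres_canon (eq_choose eq_uv).
by apply: choose_id; apply/asboolP => //; [exact: pres_sym|exact: pres_refl].
Qed.

Definition decode (c : nat) : word n := odflt [::] (unpickle c).

Lemma decodeK w : decode (pickle w) = w.
Proof. by rewrite /decode pickleK. Qed.

(* The group with generators x_1, ..., x_n and relators R: the quotient of the
   words by [pres_eq R], a class being given by the code in [nat] of its
   canonical representative.  With {eq_quot _} the carrier would live in too
   large a universe for a [smallGroup]. *)
Definition presented : Type :=
  {c : nat | pickle (pres_canon (decode c)) == c}.

Lemma pres_pi_subproof w :
  let c := pickle (pres_canon w) in pickle (pres_canon (decode c)) == c.
Proof.
rewrite /= decodeK; apply/eqP; congr pickle.
exact/pres_canonP/pres_sym/pres_canon_eq.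
Qed.

Definition pres_pi (w : word n) : presented :=
  exist _ (pickle (pres_canon w)) (pres_pi_subproof w).
Definition pres_repr (x : presented) : word n := decode (val x).

Lemma pres_reprK : cancel pres_repr pres_pi.
Proof. by move=> x; apply/val_inj/eqP/(valP x). Qed.

Lemma pres_piP u v : pres_pi u = pres_pi v <-> pres_eq R u v.
Proof.
split=> [/(congr1 val)/=/(congr1 decode)|uv].
  by rewrite !decodeK => /pres_canonP.
by apply/val_inj; congr pickle; apply/pres_canonP.
Qed.

Lemma pres_repr_pi w : pres_eq R (pres_repr (pres_pi w)) w.
Proof. by rewrite /pres_repr decodeK; exact/pres_sym/pres_canon_eq. Qed.

Definition pres_one : presented := pres_pi [::].
Definition pres_mul (x y : presented) : presented :=
  pres_pi (pres_repr x ++ pres_repr y).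
Definition pres_invg (x : presented) : presented :=
  pres_pi (inv_word (pres_repr x)).

Lemma pres_mulE u v : pres_mul (pres_pi u) (pres_pi v) = pres_pi (u ++ v).
Proof. by apply/pres_piP/pres_cat; exact: pres_repr_pi. Qed.

Lemma pres_invE u : pres_invg (pres_pi u) = pres_pi (inv_word u).
Proof. exact/pres_piP/pres_inv/pres_repr_pi. Qed.

Lemma pres_mulA : associative pres_mul.
Proof.
move=> x y z; rewrite -[x]pres_reprK -[y]pres_reprK -[z]pres_reprK.
by rewrite !pres_mulE catA.
Qed.

Lemma pres_mul1g : left_id pres_one pres_mul.
Proof. by move=> x; rewrite -[x]pres_reprK pres_mulE. Qed.

Lemma pres_mulg1 : right_id pres_one pres_mul.
Proof. by move=> x; rewrite -[x]pres_reprK pres_mulE cats0. Qed.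

Lemma pres_mulVg : left_inverse pres_one pres_invg pres_mul.
Proof.
move=> x; rewrite -[x]pres_reprK pres_invE pres_mulE.
exact/pres_piP/pres_invl.
Qed.

Lemma pres_mulgV : right_inverse pres_one pres_invg pres_mul.
Proof.
move=> x; rewrite -[x]pres_reprK pres_invE pres_mulE.
exact/pres_piP/pres_invr.
Qed.

Definition presented_group : smallGroup :=
  SmallGroup pres_mulA pres_mul1g pres_mulg1 pres_mulVg pres_mulgV.

Definition pres_marking : seq presented_group :=
  [seq pres_pi [:: (i, false)] | i <- enum 'I_n].

Lemma pres_marking_generates (H : {pred presented_group}) :
  group_closed H -> {subset pres_marking <= H} -> forall x, x \in H.
Proof.
move=> gH sH x; rewrite -[x]pres_reprK; elim: (pres_repr x) => [|[i b] w IHw].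
  exact: gH.1.
have Hi : pres_pi [:: (i, false)] \in H.
  by apply/sH/map_f; rewrite mem_enum.
rewrite -cat1s -pres_mulE; apply: (group_closedM gH) => //.
by case: b => //; rewrite -[[:: _]]/(inv_word [:: (i, false)]) -pres_invE;
  exact: (group_closedV gH).
Qed.

Definition presentation : markedGroup :=
  MarkedGroup pres_marking_generates.

End Presentation.

Local Close Scope group_scope.

(* The class of graphs of partial recursive functions: the smallest class that
   contains the basic functions and is closed under composition, primitive
   recursion and unbounded minimization. *)

Definition comp_graph k m (f : m.-tuple nat -> nat -> Prop)
    (g : 'I_m -> k.-tuple nat -> nat -> Prop) (v : k.-tuple nat) (y : nat) :=
  exists2 w : m.-tuple nat, (forall i, g i v (tnth w i)) & f w y.

Fixpoint prec_iter k (f : k.-tuple nat -> nat -> Prop)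
    (g : k.+2.-tuple nat -> nat -> Prop) (x : nat) (v : k.-tuple nat) (y : nat)
    : Prop :=
  if x is x'.+1
  then exists2 z, prec_iter f g x' v z & g [tuple of x' :: z :: v] y
  else f v y.

Definition prec_graph k (f : k.-tuple nat -> nat -> Prop)
    (g : k.+2.-tuple nat -> nat -> Prop) (v : k.+1.-tuple nat) (y : nat) :=
  prec_iter f g (thead v) [tuple of behead v] y.

Definition mu_graph k (f : k.+1.-tuple nat -> nat -> Prop)
    (v : k.-tuple nat) (y : nat) :=
  f [tuple of y :: v] 0 /\
  forall z, z < y -> exists t, f [tuple of z :: v] t.+1.

Inductive recursive_graph :
    forall k : nat, (k.-tuple nat -> nat -> Prop) -> Prop :=
| rec_zero k : @recursive_graph k (fun _ y => y = 0)
| rec_succ : @recursive_graph 1 (fun v y => y = (thead v).+1)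
| rec_proj k (i : 'I_k) : @recursive_graph k (fun v y => y = tnth v i)
| rec_comp k m (f : m.-tuple nat -> nat -> Prop)
    (g : 'I_m -> k.-tuple nat -> nat -> Prop) :
    recursive_graph f -> (forall i, recursive_graph (g i)) ->
    recursive_graph (comp_graph f g)
| rec_prec k (f : k.-tuple nat -> nat -> Prop)
    (g : k.+2.-tuple nat -> nat -> Prop) :
    recursive_graph f -> recursive_graph g -> recursive_graph (prec_graph f g)
| rec_mu k (f : k.+1.-tuple nat -> nat -> Prop) :
    recursive_graph f -> recursive_graph (mu_graph f).

(* A partial function is represented by a function to [option nat], [None]
   meaning undefined. *)
Definition partial_computable k (F : k.-tuple nat -> option nat) : Prop :=
  recursive_graph (fun v y => F v = Some y).

Definition partial_computable1 (F : nat -> option nat) : Prop :=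
  partial_computable (fun v : 1.-tuple nat => F (thead v)).

Definition partial_computable2 (F : nat -> nat -> option nat) : Prop :=
  partial_computable (fun v : 2.-tuple nat => F (nth 0 v 0) (nth 0 v 1)).

Definition computable1 (f : nat -> nat) : Prop :=
  partial_computable1 (fun x => Some (f x)).

Definition computable2 (f : nat -> nat -> nat) : Prop :=
  partial_computable2 (fun x y => Some (f x y)).

Definition computable3 (f : nat -> nat -> nat -> nat) : Prop :=
  partial_computable
    (fun v : 3.-tuple nat => Some (f (nth 0 v 0) (nth 0 v 1) (nth 0 v 2))).

(* Acceptable (standard) numberings in the sense of Rogers. *)
Definition standard_enumeration (phi : nat -> nat -> option nat) : Prop :=
  partial_computable2 phi /\
  forall psi : nat -> nat -> option nat, partial_computable2 psi ->
    exists2 s : nat -> nat, computable1 s & forall e, phi (s e) =1 psi e.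

(* [fst] and [snd] are the components of the inverse of [pair]. *)
Definition computable_pairing (pair : nat -> nat -> nat) (fst snd : nat -> nat)
    : Prop :=
  [/\ computable2 pair, computable1 fst, computable1 snd &
    [/\ forall n m, fst (pair n m) = n, forall n m, snd (pair n m) = m
      & forall p, pair (fst p) (snd p) = p]].

(* The code 2i of x_(i+1), and 2i+1 of its inverse. *)
Definition letter_code n (a : letter n) : nat := a.1.*2 + a.2.

(* A map to words is computable when the length and the letters of its values
   are; as theta_n is a bijection, its inverse is then computable by search. *)
Definition computable_words (theta : forall n, nat -> word n) : Prop :=
  [/\ forall n, 0 < n -> bijective (theta n),
      computable2 (fun n m => size (theta n m)) &
      computable3 (fun n m j => nth 0 (map (@letter_code n) (theta n m)) j)].

Section RecursivePresentations.
Variables (fst snd : nat -> nat) (theta : forall n, nat -> word n).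
Variable phi : nat -> nat -> option nat.

Definition W (i : nat) : set nat := [set m | phi i m].

Definition nuRP (p : nat) : markedClass :=
  \pi_markedClass (presentation (theta (fst p) @` W (snd p))).

(* The alphabets x_1, ..., x_n are those with n >= 1. *)
Definition dom_nuRP : set nat := [set p | 0 < fst p].

Definition GRP : set (scott markedClass) := nuRP @` dom_nuRP.

Definition semidecidable (A : set GRP) : Prop :=
  exists2 F : nat -> option nat, partial_computable1 F &
    forall p, dom_nuRP p -> F p <-> (set_val @` A) (nuRP p).

(* A copy of GRP, endowed with the topology generated by the semi-decidable
   sets; [GRP] itself carries the topology induced by the Scott topology. *)
Definition GRP_semidec : Type := GRP.
HB.instance Definition _ := Choice.on GRP_semidec.
HB.instance Definition _ :=
  isSubBaseTopological.Build GRP_semidec semidecidable id.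

End RecursivePresentations.

(* Main.v *)
(* For a fixed number n of generators, marked groups are ordered as the normal
   subgroups of the free group, and finitely presented ones are the compact
   elements: a directed supremum is presented by the union of the relations of
   the members, so it satisfies finitely many given relators only if some member
   does.  Hence a Scott open set is a union of up-sets of finitely presented
   marked groups.  Within G_RP such an up-set is semi-decidable, because the
   consequences of a computably enumerable set of relators can be enumerated.

   Conversely, a semi-decidable set A is Scott open by the argument of Rice and
   Shapiro.  Let K be the halting set and e |-> R_e a computable family of
   computably enumerable sets of relators.  If R_e presents an element of A for
   all e outside K, it does so for some e in K, for otherwise the complement of
   K would be computably enumerable.  With R_e = R for e outside K and
   R_e = R u R' for e in K, A is an upper set; with R_e = R for e outside K and
   R_e a finite subset of R for e in K, every element of A lies above a finitely
   presented element of A. *)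

From HB Require Import structures.
Require Import Defs.
From mathcomp Require Import all_boot all_order.
From mathcomp Require Import boolp classical_sets functions topology.

Set Implicit Arguments.
Unset Strict Implicit.
Unset Printing Implicit Defensive.

Local Open Scope classical_set_scope.

(** * Recursive functions *)

(* An environment [v] assigns to the variable i the value [nth 0 v i]; a
   function of environments is recursive when its restrictions to all arities
   are. *)
Definition Rec (f : seq nat -> nat) : Prop :=
  forall k, recursive_graph (fun (v : k.-tuple nat) y => y = f v).

(** The length of [e v] may depend only on the length of [v]: then, at each arity, composition with
    [e] feeds a function of one fixed arity. *)
Definition RecEnv (e : seq nat -> seq nat) : Prop :=
  (forall k, exists m, forall v, size v = k -> size (e v) = m) /\
  forall i, Rec (fun v => nth 0 (e v) i).

Lemma recursive_graph_ext k (G G' : k.-tuple nat -> nat -> Prop) :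
  (forall v y, G v y <-> G' v y) -> recursive_graph G -> recursive_graph G'.
Proof.
move=> GG'; suff -> : G = G' by [].
by apply/funext => v; apply/funext => y; apply/propext.
Qed.

(** Asking for [f] at the single arity [m] makes this usable for the given computable functions,
    whose graphs are known at one arity only. *)
Lemma recursive_graph_comp m (f : seq nat -> nat) (e : seq nat -> seq nat) k :
  recursive_graph (fun (v : m.-tuple nat) y => y = f v) ->
  (forall v : k.-tuple nat, size (e v) = m) ->
  (forall i, Rec (fun v => nth 0 (e v) i)) ->
  recursive_graph (fun (v : k.-tuple nat) y => y = f (e v)).
Proof.
move=> rf em re; apply: (recursive_graph_ext _ (rec_comp rf (fun i => re i k))).
move=> v y; split=> [[w we ->]|->].
  congr f; apply: (@eq_from_nth _ 0); rewrite size_tuple ?em // => i im.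
  by rewrite -[i]/(val (Ordinal im)) -tnth_nth we.
exists (tcast (em v) (in_tuple (e v))); last by rewrite val_tcast.
by move=> i; rewrite (tnth_nth 0) val_tcast.
Qed.

Lemma Rec_comp f e : Rec f -> RecEnv e -> Rec (fun v => f (e v)).
Proof.
move=> rf [se re] k; have [m em] := se k.
by apply: (recursive_graph_comp (e := e) (rf m)) => // v; rewrite em ?size_tuple.
Qed.

Lemma Rec_nth i : Rec (fun v => nth 0 v i).
Proof.
move=> k; case: (ltnP i k) => ik.
  apply: (recursive_graph_ext _ (rec_proj (Ordinal ik))) => v y.
  by rewrite (tnth_nth 0).
(* Beyond the arity, [nth] returns its default 0, so the function is the zero function. *)
apply: (recursive_graph_ext _ (rec_zero k)) => v y.
by rewrite nth_default ?size_tuple.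
Qed.

Lemma Rec_head : Rec (head 0).
Proof.
have -> : head 0 = fun v => nth 0 v 0 by apply/funext => -[].
exact: Rec_nth.
Qed.

Lemma RecEnv_id : RecEnv id.
Proof. by split=> [k|i]; [exists k|exact: Rec_nth]. Qed.

Lemma RecEnv_behead e : RecEnv e -> RecEnv (fun v => behead (e v)).
Proof.
move=> [se re]; split=> [k|i].
  by have [m em] := se k; exists m.-1 => v vk; rewrite size_behead em.
have -> : (fun v => nth 0 (behead (e v)) i) = fun v => nth 0 (e v) i.+1.
  by apply/funext => v; rewrite nth_behead.
exact: re.
Qed.

Lemma RecEnv_cons a e : Rec a -> RecEnv e -> RecEnv (fun v => a v :: e v).
Proof.
move=> ra [se re]; split=> [k|[|i]] //; last exact: re.
by have [m em] := se k; exists m.+1 => v vk /=; rewrite em.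
Qed.

Lemma RecEnv_nil : RecEnv (fun=> [::]).
Proof.
split=> [k|i k]; first by exists 0.
by apply: (recursive_graph_ext _ (rec_zero k)) => v y; rewrite nth_nil.
Qed.

Lemma RecEnv_comp e e' : RecEnv e -> RecEnv e' -> RecEnv (fun v => e (e' v)).
Proof.
move=> [se re] re'; split=> [k|i]; last exact: Rec_comp (re i) re'.
have [m em] := re'.1 k; have [p ep] := se m.
by exists p => v vk; rewrite ep // em.
Qed.

Lemma RecEnv_mkseq (f : nat -> seq nat -> nat) m :
  (forall i, Rec (f i)) -> RecEnv (fun v => mkseq (f^~ v) m).
Proof.
move=> rf; split=> [k|i]; first by exists m => v; rewrite size_mkseq.
have [im|mi] := ltnP i m.
  have -> : (fun v => nth 0 (mkseq (f^~ v) m) i) = f i.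
    by apply/funext => v; rewrite nth_mkseq.
  exact: rf.
have -> : (fun v => nth 0 (mkseq (f^~ v) m) i) = fun v => nth 0 [::] i.
  by apply/funext => v; rewrite nth_nil nth_default ?size_mkseq.
exact: RecEnv_nil.2.
Qed.

Lemma Rec_fun1 g a : computable1 g -> Rec a -> Rec (fun v => g (a v)).
Proof.
move=> cg ra k.
have rg : recursive_graph (fun (v : 1.-tuple nat) y => y = g (nth 0 v 0)).
  apply: recursive_graph_ext cg => v y; case: v => -[|x [|]] //= vs.
  by rewrite /thead (tnth_nth 0) /=; split=> [[]|->].
have e1 := RecEnv_cons ra RecEnv_nil.
exact: (recursive_graph_comp (f := fun v => g (nth 0 v 0)) rg _ e1.2).
Qed.

Lemma Rec_fun2 g a b :
  computable2 g -> Rec a -> Rec b -> Rec (fun v => g (a v) (b v)).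
Proof.
move=> cg ra rb k.
have rg : recursive_graph
    (fun (v : 2.-tuple nat) y => y = g (nth 0 v 0) (nth 0 v 1)).
  by apply: recursive_graph_ext cg => v y; split=> [[]|->].
have e2 := RecEnv_cons ra (RecEnv_cons rb RecEnv_nil).
exact: (recursive_graph_comp (f := fun v => g (nth 0 v 0) (nth 0 v 1)) rg _ e2.2).
Qed.

Lemma Rec_fun3 g a b c : computable3 g -> Rec a -> Rec b -> Rec c ->
  Rec (fun v => g (a v) (b v) (c v)).
Proof.
move=> cg ra rb rc k.
have rg : recursive_graph
    (fun (v : 3.-tuple nat) y => y = g (nth 0 v 0) (nth 0 v 1) (nth 0 v 2)).
  by apply: recursive_graph_ext cg => v y; split=> [[]|->].
have e3 := RecEnv_cons ra (RecEnv_cons rb (RecEnv_cons rc RecEnv_nil)).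
exact: (recursive_graph_comp
  (f := fun v => g (nth 0 v 0) (nth 0 v 1) (nth 0 v 2)) rg _ e3.2).
Qed.

Lemma Rec_succ a : Rec a -> Rec (fun v => (a v).+1).
Proof.
apply: Rec_fun1; apply: recursive_graph_ext rec_succ => v y.
by split=> [->|[]].
Qed.

Lemma Rec_const c : Rec (fun=> c).
Proof. by elim: c => [|c IHc]; [exact: rec_zero|exact: Rec_succ IHc]. Qed.

Lemma Rec_iteri m f (g : nat -> nat -> seq nat -> nat) :
  Rec m -> Rec f ->
  Rec (fun w => g (head 0 w) (head 0 (behead w)) (behead (behead w))) ->
  Rec (fun v => iteri (m v) (fun i z => g i z v) (f v)).
Proof.
move=> rm rf rg.
(* The bound becomes a separate leading variable, the recursion argument of [rec_prec]; substituting
   [m v :: v] then recovers the claim. *)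
pose h w := iteri (head 0 w) (fun i z => g i z (behead w)) (f (behead w)).
suff rh k : recursive_graph (fun (v : k.+1.-tuple nat) y => y = h v).
  move=> k; apply: (recursive_graph_comp (f := h) (rh k)
    (e := fun v => m v :: v)).
  - by move=> v /=; rewrite size_tuple.
  - by case=> // i; exact: Rec_nth.
apply: (recursive_graph_ext _ (rec_prec (rf k) (rg k.+2))) => v y.
case/tupleP: v => x v; rewrite /prec_graph /h theadE /=.
have -> : [tuple of behead [tuple of x :: v]] = v by exact: val_inj.
elim: x y => [|x IHx] y //=; split=> [[z /IHx -> ->] //|->].
by exists (iteri x (fun i z => g i z v) (f v)); first exact/IHx.
Qed.

Lemma Rec_add a b : Rec a -> Rec b -> Rec (fun v => a v + b v).
Proof.
move=> ra rb.
have -> : (fun v => a v + b v) = fun v => iteri (a v) (fun _ z => z.+1) (b v).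
  by apply/funext => v; elim: (a v) => //= n IHn; rewrite addSn IHn.
apply: (Rec_iteri (g := fun _ z _ => z.+1)) => //.
exact/Rec_succ/(Rec_comp Rec_head)/RecEnv_behead/RecEnv_id.
Qed.

Lemma Rec_mul a b : Rec a -> Rec b -> Rec (fun v => a v * b v).
Proof.
move=> ra rb.
have -> : (fun v => a v * b v) =
    fun v => iteri (a v) (fun _ z => b v + z) 0.
  by apply/funext => v; elim: (a v) => //= n IHn; rewrite mulSn IHn.
apply: (Rec_iteri (g := fun _ z v => b v + z)) => //; first exact: Rec_const.
have e1 := RecEnv_behead RecEnv_id.
apply: Rec_add; last exact: (Rec_comp Rec_head e1).
exact/(Rec_comp rb)/RecEnv_behead.
Qed.

Lemma Rec_sub a b : Rec a -> Rec b -> Rec (fun v => a v - b v).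
Proof.
move=> ra rb.
have rp c : Rec c -> Rec (fun v => (c v).-1).
  move=> rc.
  have -> : (fun v => (c v).-1) = fun v => iteri (c v) (fun i _ => i) 0.
    by apply/funext => v; case: (c v).
  apply: (Rec_iteri (g := fun i _ _ => i)) => //; first exact: Rec_const.
  exact: Rec_head.
have -> : (fun v => a v - b v) = fun v => iteri (b v) (fun _ z => z.-1) (a v).
  by apply/funext => v; elim: (b v) => [|n IHn] /=; rewrite ?subn0 // subnS IHn.
apply: (Rec_iteri (g := fun _ z _ => z.-1)) => //.
exact/rp/(Rec_comp Rec_head)/RecEnv_behead/RecEnv_id.
Qed.

Lemma Rec_sum m (g : nat -> seq nat -> nat) :
  Rec m -> Rec (fun w => g (head 0 w) (behead w)) ->
  Rec (fun v => \sum_(i < m v) g i v).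
Proof.
move=> rm rg.
have -> : (fun v => \sum_(i < m v) g i v) =
    fun v => iteri (m v) (fun i z => z + g i v) 0.
  apply/funext => v; elim: (m v) => [|n IHn]; first by rewrite big_ord0.
  by rewrite big_ord_recr IHn.
have e1 := RecEnv_behead RecEnv_id.
apply: (Rec_iteri (g := fun i z v => z + g i v)) => //; first exact: Rec_const.
apply: Rec_add; first exact: (Rec_comp Rec_head e1).
exact: (Rec_comp rg (RecEnv_cons Rec_head (RecEnv_behead e1))).
Qed.

Lemma Rec_head_comp e : RecEnv e -> Rec (fun v => head 0 (e v)).
Proof. exact: Rec_comp Rec_head. Qed.

Ltac rec_env := repeat first
  [ assumption | apply: RecEnv_id | apply: RecEnv_nil | apply: RecEnv_behead
  | apply: RecEnv_cons | apply: Rec_const | apply: Rec_nth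
  | apply: Rec_head_comp | apply: Rec_succ | apply: Rec_add | apply: Rec_sub
  | apply: Rec_mul ].

Lemma Rec_behead a : Rec a -> Rec (fun w => a (behead w)).
Proof. by move=> ra; apply: Rec_comp ra _; rec_env. Qed.

(** * Computably enumerable predicates *)

(** The Sigma_1 normal form: a projection of the zero set of a total recursive function. Totality of
    [D] allows witnesses to be combined by sums and products, without dovetailing. *)
Definition CE (P : seq nat -> Prop) : Prop :=
  exists2 D, Rec D & forall v, P v <-> exists t, D (t :: v) = 0.

Lemma CE_ext P Q : (forall v, P v <-> Q v) -> CE P -> CE Q.
Proof. by move=> PQ [D rD PD]; exists D => // v; rewrite -PQ. Qed.

Lemma CE_comp P e : CE P -> RecEnv e -> CE (fun v => P (e v)).
Proof.
move=> [D rD PD] re; exists (fun w => D (head 0 w :: e (behead w))).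
  apply: (Rec_comp rD (e := fun w => head 0 w :: e (behead w))).
  by apply: RecEnv_cons Rec_head _; apply: RecEnv_comp => //; rec_env.
by move=> v; apply: PD.
Qed.

Lemma CE_eq a b : Rec a -> Rec b -> CE (fun v => a v = b v).
Proof.
move=> ra rb; have e1 := RecEnv_behead RecEnv_id.
(* The sum of the two truncated differences is the distance between the values; it does not depend
   on the witness at the head of [w]. *)
exists (fun w => (a (behead w) - b (behead w)) + (b (behead w) - a (behead w))).
  have ra1 := Rec_comp ra e1; have rb1 := Rec_comp rb e1.
  by rec_env.
move=> v /=; split=> [->|[_ /eqP]]; first by exists 0; rewrite subnn.
by rewrite addn_eq0 !subn_eq0 -eqn_leq => /eqP.
Qed.

Lemma CE_lt a b : Rec a -> Rec b -> CE (fun v => a v < b v).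
Proof.
move=> ra rb; have rs : Rec (fun v => (a v).+1 - b v) by rec_env.
apply: (CE_ext _ (CE_eq rs (Rec_const 0))) => v.
by split=> [/eqP|]; [rewrite subn_eq0|move=> ?; apply/eqP; rewrite subn_eq0].
Qed.

(** * Coded sequences, and the link between recursive graphs and enumerability *)

Section CodedSequences.
Variables (pair : nat -> nat -> nat) (fst snd : nat -> nat).
Hypothesis hpair : computable_pairing pair fst snd.

Let fstK n m : fst (pair n m) = n. Proof. by case: hpair => _ _ _ []. Qed.
Let sndK n m : snd (pair n m) = m. Proof. by case: hpair => _ _ _ []. Qed.

(** Every number codes an infinite sequence, and any finite prefix can be prescribed. This does the
    work of Goedel's beta function; no length is stored. *)
Definition seq_decode (c i : nat) : nat := fst (iter i snd c).

Lemma seq_decode_exists (f : nat -> nat) m :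
  exists c, forall i, i < m -> seq_decode c i = f i.
Proof.
elim: m f => [|m IHm] f; first by exists 0.
have [c cf] := IHm (fun i => f i.+1); exists (pair (f 0) c) => -[|i] im.
  exact: fstK.
by rewrite /seq_decode iterSr sndK -/(seq_decode c i) cf.
Qed.

Lemma Rec_fst a : Rec a -> Rec (fun v => fst (a v)).
Proof. by apply: Rec_fun1; case: hpair. Qed.

Lemma Rec_snd a : Rec a -> Rec (fun v => snd (a v)).
Proof. by apply: Rec_fun1; case: hpair. Qed.

Lemma Rec_seq_decode a b :
  Rec a -> Rec b -> Rec (fun v => seq_decode (a v) (b v)).
Proof.
move=> ra rb; apply: Rec_fst.
have -> : (fun v => iter (b v) snd (a v)) =
    fun v => iteri (b v) (fun _ z => snd z) (a v).
  by apply/funext => v; elim: (b v) => //= n ->.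
apply: (Rec_iteri (g := fun _ z _ => snd z)) => //.
by apply: Rec_snd; rec_env.
Qed.

Lemma CE_and P Q : CE P -> CE Q -> CE (fun v => P v /\ Q v).
Proof.
move=> [D rD PD] [E rE QE].
exists (fun w => D (fst (head 0 w) :: behead w) + E (snd (head 0 w) :: behead w)).
  apply: Rec_add.
    apply: (Rec_comp rD (e := fun w => fst (head 0 w) :: behead w)).
    by apply: RecEnv_cons; [apply: Rec_fst|]; rec_env.
  apply: (Rec_comp rE (e := fun w => snd (head 0 w) :: behead w)).
  by apply: RecEnv_cons; [apply: Rec_snd|]; rec_env.
move=> v; rewrite PD QE; split=> [[[t Dt] [s Es]]|[t /eqP]] /=.
  by exists (pair t s); rewrite fstK sndK Dt.
by rewrite addn_eq0 => /andP[/eqP Dt /eqP Et]; split; eexists; eassumption.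
Qed.

Lemma CE_and3 P Q S : CE P -> CE Q -> CE S -> CE (fun v => [/\ P v, Q v & S v]).
Proof.
move=> cP cQ cS; apply: (CE_ext _ (CE_and (CE_and cP cQ) cS)) => v.
by split=> [[[]]|[]].
Qed.

Lemma CE_or P Q : CE P -> CE Q -> CE (fun v => P v \/ Q v).
Proof.
move=> [D rD PD] [E rE QE]; exists (fun w => D w * E w).
  exact: Rec_mul.
move=> v; rewrite PD QE; split=> [[[t Dt]|[t Et]]|[t /eqP]].
- by exists t; rewrite Dt.
- by exists t; rewrite Et muln0.
- by rewrite muln_eq0 => /orP[] /eqP Dt; [left|right]; exists t.
Qed.

Lemma CE_exists (P : nat -> seq nat -> Prop) :
  CE (fun w => P (head 0 w) (behead w)) -> CE (fun v => exists x, P x v).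
Proof.
move=> [D rD PD].
exists (fun w => D (fst (head 0 w) :: snd (head 0 w) :: behead w)).
  apply: (Rec_comp rD (e := fun w => fst (head 0 w) :: snd (head 0 w) :: behead w)).
  apply: RecEnv_cons; first by apply: Rec_fst; rec_env.
  by apply: RecEnv_cons; [apply: Rec_snd|]; rec_env.
move=> v; split=> [[x /(PD (x :: v))[t Dt]]|[t Dt]].
  by exists (pair t x); rewrite /= fstK sndK.
by exists (snd t); apply/(PD (snd t :: v)); exists (fst t).
Qed.

(** One number codes the witnesses for all [i] below the bound, and a sum of natural numbers
    vanishes exactly when each term does. *)
Lemma CE_forall_lt m (P : nat -> seq nat -> Prop) :
  Rec m -> CE (fun w => P (head 0 w) (behead w)) ->
  CE (fun v => forall i, i < m v -> P i v).
Proof.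
move=> rm [D rD PD].
pose S w := \sum_(i < m (behead w))
  D (seq_decode (head 0 w) i :: nat_of_ord i :: behead w).
exists S.
  apply: (Rec_sum (g := fun i w => D (seq_decode (head 0 w) i :: i :: behead w))).
    by apply: Rec_comp => //; rec_env.
  apply: (Rec_comp rD (e := fun w =>
    seq_decode (head 0 (behead w)) (head 0 w) :: head 0 w :: behead (behead w))).
  by apply: RecEnv_cons; first apply: Rec_seq_decode; rec_env.
move=> v; rewrite /S /=; split=> [Pv|[c /eqP]].
  have /choice[f fP] i : exists t, i < m v -> D [:: t, i & v] = 0.
    case: (ltnP i (m v)) => [/Pv/(PD (i :: v))[t Dt]|_]; first by exists t.
    by exists 0.
  have [c cf] := seq_decode_exists f (m v); exists c.
  by apply/eqP; rewrite sum_nat_eq0; apply/forallP => i /=; rewrite cf // fP.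
rewrite sum_nat_eq0 => /forallP cP i im; apply/(PD (i :: v)).
by exists (seq_decode c i); apply/eqP/(cP (Ordinal im)).
Qed.

(** [Q] is fixed, so a classical case distinction picks one of two constant predicates. *)
Lemma CE_const (Q : Prop) : CE (fun=> Q).
Proof.
have [q|nq] := pselect Q.
  by apply: (CE_ext _ (CE_eq (Rec_const 0) (Rec_const 0))).
by apply: (CE_ext _ (CE_eq (Rec_const 0) (Rec_const 1))).
Qed.

Lemma CE_forall_in (T : eqType) (s : seq T) (P : T -> seq nat -> Prop) :
  (forall i, CE (P i)) -> CE (fun v => forall i, i \in s -> P i v).
Proof.
move=> cP; elim: s => [|i s IHs].
  by apply: (CE_ext _ (CE_const True)).
apply: (CE_ext _ (CE_and (cP i) IHs)) => v; split=> [[Pi Ps] j|Ps].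
  by rewrite in_cons => /predU1P[->|/Ps].
by split=> [|j js]; apply: Ps; rewrite in_cons ?eqxx ?js ?orbT.
Qed.

Lemma CE_exists_in (T : eqType) (s : seq T) (P : T -> seq nat -> Prop) :
  (forall i, CE (P i)) -> CE (fun v => exists2 i, i \in s & P i v).
Proof.
move=> cP; elim: s => [|i s IHs].
  by apply: (CE_ext _ (CE_const False)) => v; split=> // -[].
apply: (CE_ext _ (CE_or (cP i) IHs)) => v; split=> [[Pi|[j js Pj]]|[j]].
- by exists i; rewrite ?mem_head.
- by exists j; rewrite // in_cons js orbT.
- by rewrite in_cons => /predU1P[->|js] Pj; [left|right; exists j].
Qed.

(** By induction on the construction of the graph. Intermediate values, in a composition or along a
    primitive recursion, are guessed as one coded sequence and then checked. *)
Lemma recursive_graph_CE k (G : k.-tuple nat -> nat -> Prop) :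
  recursive_graph G ->
  exists2 P, CE P & forall (v : k.-tuple nat) y, G v y <-> P (y :: v).
Proof.
elim=> {k G}
  [k||k i|k m f g _ [Pf cf Pfe] _ IHg|k f g _ [Pf cf Pfe] _ [Pg cg Pge]
  |k f _ [Pf cf Pfe]].
- exists (fun w => head 0 w = 0) => //.
  by apply: CE_eq; rec_env.
- exists (fun w => head 0 w = (nth 0 w 1).+1).
    by apply: CE_eq; rec_env.
  by move=> v y /=; case/tupleP: v => x v; rewrite theadE.
- exists (fun w => head 0 w = nth 0 w i.+1).
    by apply: CE_eq; rec_env.
  by move=> v y /=; rewrite (tnth_nth 0).
- have /choice[Pg Pgi] i : exists P, CE P /\
      forall (v : k.-tuple nat) y, g i v y <-> P (y :: v).
    by have [P ? ?] := IHg i; exists P.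
  exists (fun w => exists c,
    (forall i, i \in enum 'I_m -> Pg i (seq_decode c i :: behead w)) /\
    Pf (head 0 w :: mkseq (seq_decode c) m)).
    apply: CE_exists; apply: CE_and.
      apply: CE_forall_in => i.
      apply: (CE_comp (Pgi i).1
        (e := fun u => seq_decode (head 0 u) i :: behead (behead u))).
      by apply: RecEnv_cons; first apply: Rec_seq_decode; rec_env.
    apply: (CE_comp cf (e := fun u => head 0 (behead u) ::
      mkseq (seq_decode (head 0 u)) m)).
    apply: RecEnv_cons; first by rec_env.
    apply: (RecEnv_mkseq (f := fun i u => seq_decode (head 0 u) i)) => i.
    by apply: Rec_seq_decode; rec_env.
  move=> v y; split=> [[w gw fw]|[c [gc fc]]] /=.
    have [c cw] := seq_decode_exists (nth 0 w) m; exists c; split.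
      by move=> i _; rewrite cw // -tnth_nth; apply/(Pgi i).2.
    move/Pfe: fw; congr Pf; congr cons; apply: (@eq_from_nth _ 0).
      by rewrite size_mkseq size_tuple.
    by move=> i; rewrite size_tuple => im; rewrite nth_mkseq // cw.
  exists (mktuple (fun i : 'I_m => seq_decode c i)).
    by move=> i; rewrite tnth_mktuple; apply/(Pgi i).2/gc; rewrite mem_enum.
  apply/Pfe; move: fc; congr Pf; congr cons; apply: (@eq_from_nth _ 0).
    by rewrite size_mkseq size_tuple.
  move=> i; rewrite size_mkseq => im; rewrite nth_mkseq //.
  by rewrite -[i in RHS]/(val (Ordinal im)) -tnth_nth tnth_mktuple.
(* Here [w] is [y :: x :: v], and [c] lists the values of the recursion at 0, ..., x. *)
- exists (fun w => exists c, [/\ Pf (seq_decode c 0 :: behead (behead w)),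
    seq_decode c (nth 0 w 1) = head 0 w & forall i, i < nth 0 w 1 ->
    Pg [:: seq_decode c i.+1, i, seq_decode c i & behead (behead w)]]).
    apply: CE_exists.
    have rx : Rec (fun u => nth 0 (behead u) 1).
      exact: Rec_behead (Rec_nth 1).
    apply: CE_and3.
    + apply: (CE_comp cf (e := fun u => _ :: behead (behead (behead u)))).
      by apply: RecEnv_cons; first apply: Rec_seq_decode; rec_env.
    + by apply: CE_eq; first apply: Rec_seq_decode; rec_env.
    + apply: CE_forall_lt => //.
      apply: (CE_comp cg (e := fun u => [:: _, head 0 u, _ &
        behead (behead (behead (behead u)))])).
      apply: RecEnv_cons; first by apply: Rec_seq_decode; rec_env.
      apply: RecEnv_cons; first by rec_env.
      by apply: RecEnv_cons; first apply: Rec_seq_decode; rec_env.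
  move=> v y; case/tupleP: v => x v; rewrite /prec_graph theadE /=.
  have -> : [tuple of behead [tuple of x :: v]] = v by exact: val_inj.
  split=> [fx|[c [fc <- gc]]].
    suff [h [h0 hx hi]] : exists h, [/\ f v (h 0), h x = y &
        forall i, i < x -> g [tuple of [:: i, h i & v]] (h i.+1)].
      have [c ch] := seq_decode_exists h x.+1; exists c; split.
      * by rewrite ch //; apply/Pfe.
      * by rewrite ch.
      * move=> i ix; rewrite !ch ?(ltnW ix) //; last exact: ltnW.
        by move/Pge: (hi _ ix).
    elim: x y fx => [|x IHx] y /= fx; first by exists (fun=> y).
    have [z /IHx[h [h0 hx hi]] gy] := fx.
    (* The history up to [x] is extended by the new value [y]. *)
    pose h' i := if i == x.+1 then y else h i.
    have h'E i : i <= x -> h' i = h i by move=> ix; rewrite /h' ltn_eqF.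
    have h'x : h' x.+1 = y by rewrite /h' eqxx.
    exists h'; split=> // i; rewrite ltnS leq_eqVlt => /predU1P[->|ix].
      by rewrite h'x h'E // hx.
    by rewrite !h'E //; [exact: hi|exact: ltnW].
  elim: x gc => [|x IHx] gc /=; first exact/Pfe.
  exists (seq_decode c x); first by apply: IHx => i ix; apply/gc/ltnW.
  exact/Pge/gc.
(* Here [w] is [y :: v]. Below [y] the value must exist and be positive, hence the form [t.+1]. *)
- exists (fun w => Pf (0 :: w) /\ forall z, z < head 0 w ->
    exists t, Pf [:: t.+1, z & behead w]).
    apply: CE_and; first by apply: (CE_comp cf); rec_env.
    apply: CE_forall_lt; first by rec_env.
    apply: CE_exists; apply: (CE_comp cf (e := fun u => [:: (head 0 u).+1,
      head 0 (behead u) & behead (behead (behead u))])); rec_env.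
  move=> v y; split=> -[fy fz]; split.
  + by move/Pfe: fy.
  + by move=> z /fz[t /Pfe ft]; exists t.
  + exact/Pfe.
  + by move=> z /fz[t ft]; exists t; apply/Pfe.
Qed.

(** Minimization searches for the least witness: it returns a value exactly where a witness
    exists. *)
Lemma CE_domain k P : CE P ->
  exists2 F : k.-tuple nat -> option nat, partial_computable F &
    forall v : k.-tuple nat, F v <-> P v.
Proof.
move=> [D rD PD].
have exb v : (exists t, D (t :: v) = 0) -> exists t, D (t :: v) == 0.
  by case=> t /eqP; exists t.
pose F (v : k.-tuple nat) :=
  if pselect (exists t, D (t :: v) = 0) is left h
  then Some (ex_minn (exb v h)) else None.
exists F; last by move=> v; rewrite PD /F; case: pselect.
apply: (recursive_graph_ext _ (rec_mu (rD k.+1))) => v y.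
rewrite /mu_graph /F /=; case: pselect => [h|nh].
  case: ex_minnP => t /eqP Dt tmin; split=> [[D0 Dz]|[<-]].
    congr Some; apply/eqP; rewrite eqn_leq tmin ?D0 //= leqNgt.
    by apply/negP => /Dz[s]; rewrite Dt.
  split=> // z zt; exists (D (z :: v)).-1; rewrite prednK // lt0n.
  by apply/negP => /tmin; rewrite leqNgt zt.
by split=> // -[D0 _]; case: nh; exists y.
Qed.

Lemma CE_partial_computable1 P : CE P ->
  exists2 F, partial_computable1 F & forall p, F p <-> P [:: p].
Proof.
move=> /(@CE_domain 1)[F cF FP]; exists (fun p => F [tuple p]) => [|p].
  apply: recursive_graph_ext cF => v y; suff -> : v = [tuple thead v] by [].
  by case/tupleP: v => x v; rewrite theadE tuple0; exact: val_inj.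
exact: FP.
Qed.

Lemma CE_partial_computable2 P : CE P ->
  exists2 psi, partial_computable2 psi & forall e p, psi e p <-> P [:: e; p].
Proof.
move=> /(@CE_domain 2)[F cF FP]; exists (fun e p => F [tuple e; p]) => [|e p].
  apply: recursive_graph_ext cF => v y.
  suff -> : v = [tuple nth 0 v 0; nth 0 v 1] by [].
  apply: val_inj; case: v => v vs /=.
  by case: v vs => [|a [|b [|]]].
exact: FP.
Qed.

Lemma CE_partial_computable1_dom F a :
  partial_computable1 F -> Rec a -> CE (fun v => F (a v)).
Proof.
move=> /recursive_graph_CE[P cP FP] ra.
apply: (@CE_ext (fun v => exists y, P [:: y; a v])) => [v|].
  split=> [[y /(FP [tuple a v])]|]; first by rewrite theadE => ->.
  case E: (F (a v)) => [y|//] _; exists y.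
  by apply/(FP [tuple a v]); rewrite theadE.
apply: CE_exists; apply: (CE_comp cP (e := fun u => [:: head 0 u; a (behead u)])).
have ra1 := Rec_behead ra.
by rec_env.
Qed.

(** * Acceptable numberings: uniform indices and the halting set *)

Section StandardEnumeration.
Variable phi : nat -> nat -> option nat.
Hypothesis hphi : standard_enumeration phi.

Lemma CE_W a b : Rec a -> Rec b -> CE (fun v => W phi (a v) (b v)).
Proof.
move=> ra rb; have [P cP FP] := recursive_graph_CE hphi.1.
apply: (@CE_ext (fun v => exists y, P [:: y; a v; b v])) => [v|].
  rewrite /W /=; split=> [[y /(FP [tuple a v; b v])/= ->] //|].
  case E: (phi (a v) (b v)) => [y|//] _; exists y.
  exact/(FP [tuple a v; b v]).
apply: CE_exists.
apply: (CE_comp cP (e := fun u => [:: head 0 u; a (behead u); b (behead u)])).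
have ra1 := Rec_behead ra.
have rb1 := Rec_behead rb.
by rec_env.
Qed.

(** The s-m-n property for enumerable sets: the sections of an enumerable relation have indices
    computable from the parameter. *)
Lemma W_parametrization P : CE P ->
  exists2 s, computable1 s & forall e m, W phi (s e) m <-> P [:: e; m].
Proof.
move=> /CE_partial_computable2[psi cpsi psiP].
by have [s cs sP] := hphi.2 psi cpsi; exists s => // e m; rewrite -psiP /W /= sP.
Qed.

(** Otherwise parametrization, with a predicate that ignores its parameter, makes [s 0] an index of
    the complement of the halting set. Asking whether that set contains [s 0] gives a
    contradiction. *)
Lemma not_CE_diagonal : ~ CE (fun v => ~ W phi (head 0 v) (head 0 v)).
Proof.
move=> nK.
have e1 := RecEnv_behead RecEnv_id.
have [s _ sP] := W_parametrization (CE_comp nK e1).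
by have := sP (s 0) (s 0); have := sP 0 (s 0); rewrite /=; tauto.
Qed.

End StandardEnumeration.
End CodedSequences.

(** * The order on marked groups *)

Lemma size_pres_marking n (R : set (word n)) :
  size (marking (presentation R)) = n.
Proof. by rewrite /= size_map size_enum_ord. Qed.

Lemma nth_pres_marking n (R : set (word n)) (i : 'I_n) x0 :
  nth x0 (marking (presentation R)) i = pres_pi R [:: (i, false)].
Proof. by rewrite /= (nth_map i) ?size_enum_ord // nth_ord_enum. Qed.

(** * Evaluation of words and morphisms out of presentations *)

Section WordEvaluation.
Local Open Scope group_scope.
Variables (X : markedGroup) (n : nat).

(** The default 1 of [nth] gives a value to letters beyond the marking, so [n] and the rank of [X]
    can be independent here. *)
Definition letter_value (a : letter n) : X :=
  let s := nth 1 (marking X) a.1 in if a.2 then s^-1 else s.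

Definition word_value (w : word n) : X :=
  foldr (fun a x => letter_value a * x) 1 w.

Lemma word_value_cat u v : word_value (u ++ v) = word_value u * word_value v.
Proof. by elim: u => [|a u IHu] /=; rewrite ?mul1g // IHu mulgA. Qed.

Lemma letter_value_inv a : letter_value (inv_letter a) = (letter_value a)^-1.
Proof. by case: a => i [] //=; rewrite /letter_value /= invgK. Qed.

Lemma word_value_inv w : word_value (inv_word w) = (word_value w)^-1.
Proof.
elim: w => [|a w IHw] /=; first by rewrite invg1.
rewrite /inv_word /= rev_cons -cats1 word_value_cat IHw /=.
by rewrite letter_value_inv mulg1 invgM.
Qed.

Definition holds (R : set (word n)) : Prop :=
  forall r, R r -> word_value r = 1.

Lemma pres_eq_word_value R u v :
  holds R -> pres_eq R u v -> word_value u = word_value v.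
Proof.
move=> hR.
elim=> {u v} [|u v _ ->|u v w _ -> _ ->|u u' v v' _ uu _ vv|a|r /hR] //.
  by rewrite !word_value_cat uu vv.
by rewrite /= letter_value_inv mulg1 mulgV.
Qed.

Lemma marked_morphism_pres_pi R (f : {multiplicative presentation R -> X}) :
  is_marked_morphism f ->
  forall w, f (pres_pi R w : presentation R) = word_value w.
Proof.
move=> fX; pose pi w : presentation R := pres_pi R w.
elim=> [|[i b] w IHw]; first exact: hom1.
have -> : pres_pi R ((i, b) :: w) = pi [:: (i, b)] * pi w.
  by rewrite -cat1s /pi -pres_mulE.
rewrite gmulfM IHw /=; congr (_ * _).
have fi : f (pi [:: (i, false)]) = nth 1 (marking X) i.
  by rewrite -fX (nth_map 1) ?size_pres_marking // nth_pres_marking.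
case: b => //; rewrite /letter_value /= -fi.
have -> : pi [:: (i, true)] = 1 / pi [:: (i, false)].
  rewrite div1g /pi -[[:: (i, true)]]/(inv_word [:: (i, false)]).
  by rewrite -pres_invE.
by rewrite homF hom1 div1g.
Qed.

(** Von Dyck's theorem. The equation on sizes is there because a marked morphism preserves the
    length of the marking. *)
Lemma presentation_quotient R :
  marked_quotient (presentation R) X <-> size (marking X) = n /\ holds R.
Proof.
split=> [[f fX]|[Xn hR]].
  have Xn : size (marking X) = n by rewrite -fX size_map size_pres_marking.
  split=> // r Rr; rewrite -(marked_morphism_pres_pi fX) -(hom1 f).
  by congr (f _); exact/pres_piP/pres_relator.
pose f (x : presentation R) : X := word_value (pres_repr x).
have fM x y : f (x * y) = f x * f y.
  rewrite /f -word_value_cat; apply: (pres_eq_word_value hR).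
  exact: pres_repr_pi.
pose fm := isMultiplicative.Build (presentation R) X f fM.
pose fmm : {multiplicative presentation R -> X} := HB.pack f fm.
exists fmm; rewrite /is_marked_morphism /= /pres_marking -map_comp.
rewrite (@eq_map _ _ _ (fun i : 'I_n => nth 1 (marking X) (val i))) => [|i].
  by rewrite -[RHS](mkseq_nth 1) /mkseq Xn -val_enum_ord -map_comp.
rewrite /= /f (pres_eq_word_value hR (pres_repr_pi _ _)) /=.
exact: mulg1.
Qed.
End WordEvaluation.

Lemma word_value_presentation n (R : set (word n)) w :
  word_value (presentation R) w = pres_pi R w.
Proof.
elim: w => [//|[i b] w IHw]; rewrite /= IHw -cat1s -pres_mulE.
suff -> : letter_value (presentation R) (i, b) = pres_pi R [:: (i, b)] by [].
rewrite /letter_value nth_pres_marking /=; case: b => //.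
by rewrite -[[:: (i, true)]]/(inv_word [:: (i, false)]) -pres_invE.
Qed.

Lemma presentation_quotient_presentation n (R R' : set (word n)) :
  marked_quotient (presentation R) (presentation R') <->
  forall r, R r -> pres_eq R' r [::].
Proof.
rewrite presentation_quotient size_pres_marking; split=> [[_ hR] r /hR|hR].
  by rewrite word_value_presentation => /pres_piP.
split=> // r /hR r1; rewrite word_value_presentation; exact/pres_piP.
Qed.

(** All relations of [X] serve as relators. Words u, v with equal values give the relator u v^-1,
    whence injectivity; the image is a subgroup containing the marking, whence surjectivity. *)
Lemma marked_group_presentation (X : markedGroup) :
  marked_iso
    (presentation [set w : word (size (marking X)) | word_value X w = 1%g]) X.
Proof.
set n := size _; set R := [set _ | _].
have hR : holds X R by [].
have [f fX] : marked_quotient (presentation R) X.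
  exact/presentation_quotient.
have fpi := marked_morphism_pres_pi fX.
exists f => //.
have finj : injective f.
  move=> x y; rewrite -[x]pres_reprK -[y]pres_reprK !fpi => xy.
  apply/pres_piP; set u := pres_repr x in xy *; set v := pres_repr y in xy *.
  have uv1 : pres_eq R (u ++ inv_word v) [::].
    by apply: pres_relator; rewrite /R /= word_value_cat word_value_inv xy mulgV.
  apply: (pres_trans (v := u ++ (inv_word v ++ v))).
    rewrite -{1}[u]cats0; apply: pres_cat (pres_refl _ _) _.
    exact/pres_sym/pres_invl.
  by rewrite catA -{2}[v]cat0s; exact: pres_cat uv1 (pres_refl _ _).
have /choice[g gK] y : exists x, f x = y.
  apply/asboolP.
  apply: (@marking_generates X [pred y | `[< exists x, f x = y >]]); first split.
  - by apply/asboolP; exists 1%g; exact: hom1.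
  - move=> u v /asboolP[x <-] /asboolP[x' <-]; apply/asboolP.
    by exists (x / x')%g; exact: homF.
  - by move=> s; rewrite -fX => /mapP[x _ ->]; apply/asboolP; exists x.
by exists g => // x; apply: finj.
Qed.

(** * Classes of presentations: order, directed suprema and compactness *)

Definition pres n (R : set (word n)) : markedClass :=
  \pi_markedClass%qT (presentation R).

(** The order is defined through chosen representatives; these are isomorphic to the given groups,
    and isomorphisms compose with quotient maps. *)
Lemma marked_le_pi X Y :
  (\pi_markedClass%qT X <= \pi_markedClass%qT Y)%O <-> marked_quotient X Y.
Proof.
have rp Z : marked_iso (repr (\pi_markedClass%qT Z)) Z.
  by have /eqmodP/asboolP := reprK (\pi_markedClass%qT Z).
split=> [/asboolP XY|XY]; last apply/asboolP.
  apply: marked_quotient_trans (marked_iso_quotient (rp Y)).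
  exact: marked_quotient_trans (marked_iso_quotient (marked_iso_sym (rp X))) XY.
apply: marked_quotient_trans (marked_iso_quotient (marked_iso_sym (rp Y))).
exact: marked_quotient_trans (marked_iso_quotient (rp X)) XY.
Qed.

Lemma pres_surjective (x : markedClass) : exists n (R : set (word n)), x = pres R.
Proof.
exists (size (marking (repr x))), [set w | word_value (repr x) w = 1%g].
rewrite -[LHS]reprK; apply/eqmodP/asboolP/marked_iso_sym.
exact: marked_group_presentation.
Qed.

Lemma pres_le n (R R' : set (word n)) :
  (pres R <= pres R')%O <-> forall r, R r -> pres_eq R' r [::].
Proof. by rewrite marked_le_pi presentation_quotient_presentation. Qed.

Lemma pres_le_rank n n' (R : set (word n)) (R' : set (word n')) :
  (pres R <= pres R')%O -> n = n'.
Proof.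
by rewrite marked_le_pi presentation_quotient size_pres_marking => -[].
Qed.

Lemma pres_eq_sub n (R R' : set (word n)) u v :
  (forall r, R r -> pres_eq R' r [::]) -> pres_eq R u v -> pres_eq R' u v.
Proof.
move=> RR'; elim=> {u v}.
- exact: pres_refl.
- by move=> u v _; exact: pres_sym.
- by move=> u v w _ uv _; exact: pres_trans.
- by move=> u u' v v' _ uu _; exact: pres_cat.
- exact: pres_cancel.
- exact: RR'.
Qed.

(** A presented group is the directed supremum of the groups presented by finite subsets of its
    relators. *)
Lemma scott_open_finite_subpresentation (O : set markedClass) n
    (R : set (word n)) :
  scott_open O -> O (pres R) ->
  exists2 s : seq (word n), [set` s] `<=` R & O (pres [set` s]).
Proof.
move=> [_ inO] OR.
pose D := [set x | exists2 s : seq (word n), [set` s] `<=` R & x = pres [set` s]].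
have dD : directed D.
  split; first by exists (pres [set` ([::] : seq (word n))]), [::].
  move=> _ _ [s sR ->] [t tR ->]; exists (pres [set` s ++ t]); split.
  - by exists (s ++ t) => // w /=; rewrite mem_cat => /orP[/sR|/tR].
  - apply/pres_le => r rs; apply: pres_relator.
    by rewrite /= mem_cat (rs : r \in s).
  - apply/pres_le => r rt; apply: pres_relator.
    by rewrite /= mem_cat (rt : r \in t) orbT.
have [|_ [[s sR ->] Os]] := inO D (pres R) dD _ OR; last by exists s.
split.
  by move=> _ [s sR ->]; apply/pres_le => r /sR; exact: pres_relator.
move=> z ubz; have [n' [R' zE]] := pres_surjective z.
have zle (s : seq (word n)) : [set` s] `<=` R -> (pres [set` s] <= z)%O.
  by move=> sR; apply: ubz; exists s.
(* The empty set of relators already forces the upper bound [z] to have rank [n]. Singletons then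
   show that [z] satisfies every relator in [R]. *)
have nn' : n = n' by have := zle [::]; rewrite zE => /(_ _)/pres_le_rank; apply.
subst n'; rewrite zE in zle *; apply/pres_le => r Rr.
have /zle/pres_le : [set` [:: r]] `<=` R by move=> w /=; rewrite inE => /eqP->.
by apply; rewrite /= mem_head.
Qed.

Lemma scott_open_above_finitely_presented n (s : seq (word n)) :
  scott_open [set x | (pres [set` s] <= x)%O].
Proof.
split; first by move=> x y /= sy yx; exact: Order.le_trans sy yx.
move=> D z [D0 dD] [ubz lbz] /= sz.
have Dn x : D x -> exists R : set (word n), x = pres R.
  move=> /ubz xz; have [n1 [R1 x1]] := pres_surjective x.
  have [n2 [R2 z2]] := pres_surjective z; rewrite {}x1 {}z2 in xz sz *.
  have ? := pres_le_rank sz; have ? := pres_le_rank xz.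
  by subst; exists R1.
(* [K] collects the relations of all members, so [pres K] is an upper bound of [D]. A derivation
   from [K] uses finitely many of them, and by directedness a single member satisfies them all. *)
pose K := [set w | exists2 R : set (word n), D (pres R) & pres_eq R w [::]].
have zK : (z <= pres K)%O.
  apply: lbz => x Dx; have [R xE] := Dn x Dx; rewrite xE in Dx *.
  apply/pres_le => r Rr; apply: pres_relator; exists R => //.
  exact: pres_relator.
have join R R' : D (pres R) -> D (pres R') -> exists2 S : set (word n),
    D (pres S) & forall u v, pres_eq R u v \/ pres_eq R' u v -> pres_eq S u v.
  move=> DR DR'; have [x [Dx]] := dD _ _ DR DR'.
  have [S xE] := Dn x Dx; rewrite {}xE in Dx *.
  move=> /pres_le RS /pres_le R'S.
  by exists S => // u v []; exact: pres_eq_sub.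
have [R0 DR0] : exists R : set (word n), D (pres R).
  by have [x Dx] := D0; have [R xE] := Dn x Dx; exists R; rewrite -xE.
have finK u v : pres_eq K u v ->
    exists2 R : set (word n), D (pres R) & pres_eq R u v.
  elim=> {u v}.
  - by move=> w; exists R0 => //; exact: pres_refl.
  - by move=> u v _ [R DR uv]; exists R => //; exact: pres_sym.
  - move=> u v w _ [R DR uv] _ [R' DR' vw]; have [S DS RS] := join _ _ DR DR'.
    by exists S => //; apply: (pres_trans (v := v)); apply: RS; [left|right].
  - move=> u u' v v' _ [R DR uu] _ [R' DR' vv]; have [S DS RS] := join _ _ DR DR'.
    by exists S => //; apply: pres_cat; apply: RS; [left|right].
  - by move=> a; exists R0 => //; exact: pres_cancel.
  - by move=> r.
have sK : forall r, r \in s -> pres_eq K r [::].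
  by apply/pres_le; exact: Order.le_trans sz zK.
suff [R DR sR] : exists2 R : set (word n), D (pres R) &
    forall r, r \in s -> pres_eq R r [::].
  by exists (pres R); split=> //; exact/pres_le.
elim: s sK {sz} => [|r s IHs] sK; first by exists R0.
have [R DR sR] : exists2 R : set (word n), D (pres R) &
    forall r, r \in s -> pres_eq R r [::].
  by apply: IHs => q qs; apply: sK; rewrite in_cons qs orbT.
have [R' DR' rR'] := finK _ _ (sK r (mem_head _ _)).
have [S DS RS] := join _ _ DR DR'; exists S => // q.
by rewrite in_cons => /predU1P[->|/sR qR]; apply: RS; [right|left].
Qed.

(** * The word problem *)

(* [pres_eq] as reachability, which coded sequences of words can witness. *)
Section Insertions.
Variables (n : nat) (R : set (word n)).

Definition insertion (x y : word n) : Prop := exists u q v,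
  [/\ R q \/ exists a, q = [:: a; inv_letter a], x = u ++ v & y = u ++ q ++ v].

Definition insdel : rel (word n) :=
  fun x y => `[< insertion x y \/ insertion y x >].

Lemma insdel_sym x y : insdel x y = insdel y x.
Proof. by apply: asbool_equiv_eq; split=> -[]; [right|left|right|left]. Qed.

Lemma insdel_ctx u v x y : insdel x y -> insdel (u ++ x ++ v) (u ++ y ++ v).
Proof.
have ins x' y' : insertion x' y' -> insertion (u ++ x' ++ v) (u ++ y' ++ v).
  move=> [u' [q [v' [Rq -> ->]]]]; exists (u ++ u'), q, (v' ++ v).
  by rewrite -!catA.
by move=> /asboolP[]/ins xy; apply/asboolP; [left|right].
Qed.

(** Paths inherit symmetry from the relation, are transitive by concatenation, and survive a context
    applied to each of their words. *)
Lemma pres_eq_path x y :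
  pres_eq R x y <-> exists2 p, path insdel x p & last x p = y.
Proof.
have ins x' y' : insertion x' y' -> pres_eq R x' y'.
  move=> [u [q [v [Rq -> ->]]]]; apply: pres_cat; first exact: pres_refl.
  rewrite -{1}[v]cat0s; apply: pres_cat; last exact: pres_refl.
  apply: pres_sym; case: Rq => [|[a ->]]; first exact: pres_relator.
  exact: pres_cancel.
split; last first.
  case=> p; elim: p x => [x _ <-|z p IHp x /= /andP[/asboolP xz pz] py].
    exact: pres_refl.
  apply: (pres_trans (v := z)); last exact: IHp.
  by case: xz => /ins //; exact: pres_sym.
have chain_trans b a c : (exists2 p, path insdel a p & last a p = b) ->
    (exists2 p, path insdel b p & last b p = c) ->
    exists2 p, path insdel a p & last a p = c.
  by move=> [p ap <-] [q bq <-]; exists (p ++ q); rewrite ?cat_path ?ap ?last_cat.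
have chain_ctx u v a b : (exists2 p, path insdel a p & last a p = b) ->
    exists2 p, path insdel (u ++ a ++ v) p & last (u ++ a ++ v) p = u ++ b ++ v.
  move=> [p ap <-]; exists (map (fun w => u ++ w ++ v) p).
    by apply: homo_path ap => w w'; exact: insdel_ctx.
  by rewrite (last_map (fun w => u ++ w ++ v)).
elim=> {x y}.
- by move=> w; exists [::].
- move=> u v _ [p up <-]; exists (rev (belast u p)).
    rewrite rev_path; apply: sub_path up => w w'; by rewrite insdel_sym.
  by case: p {up} => //= w p; rewrite rev_cons last_rcons.
- by move=> u v w _ uv _; exact: chain_trans.
(* The left factor is rewritten first, in the context of [v], then the right one in the context of
   [u']. *)
- move=> u u' v v' _ uu _ vv; apply: (chain_trans (u' ++ v)).
    exact: (chain_ctx [::] v).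
  by have := chain_ctx u' [::] _ _ vv; rewrite !cats0.
- move=> a; exists [:: [::]] => //=; rewrite andbT; apply/asboolP; right.
  by exists [::], [:: a; inv_letter a], [::]; split=> //; right; exists a.
- move=> r Rr; exists [:: [::]] => //=; rewrite andbT; apply/asboolP; right.
  by exists [::], r, [::]; split=> //; [left|rewrite cats0].
Qed.
End Insertions.

(** Parity recovers the exponent, and halving the index. *)
Lemma letter_code_inj n : injective (@letter_code n).
Proof.
move=> [i b] [j c] /= /eqP; rewrite /letter_code /= => /eqP ij.
have := congr1 odd ij; rewrite !oddD !odd_double /= !oddb => bc.
have := congr1 half ij; rewrite ![_.*2 + _]addnC !half_bit_double.
by rewrite bc => /val_inj ->.
Qed.

Section WordProblem.
Variables (pair : nat -> nat -> nat) (fst snd : nat -> nat).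
Hypothesis hpair : computable_pairing pair fst snd.
Variable theta : forall n : nat, nat -> word n.
Hypothesis htheta : computable_words theta.
Variable phi : nat -> nat -> option nat.
Hypothesis hphi : standard_enumeration phi.

Lemma CE_theta_cat n a b c : Rec a -> Rec b -> Rec c ->
  CE (fun v => theta n (c v) = theta n (a v) ++ theta n (b v)).
Proof.
move=> ra rb rc; case: htheta => _ csize cnth.
have rsize d : Rec d -> Rec (fun v => size (theta n (d v))).
  exact: (Rec_fun2 csize (Rec_const n)).
pose L x j := nth 0 (map (@letter_code n) (theta n x)) j.
have rL d e : Rec d -> Rec e -> Rec (fun v => L (d v) (e v)).
  exact: (Rec_fun3 cnth (Rec_const n)).
(* Words are compared by length and letter by letter, as these are what is computable from codes.
   The bound [size <= j] is written with [j.+1] to fit [CE_lt]. *)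
apply: (@CE_ext (fun v =>
  size (theta n (c v)) = size (theta n (a v)) + size (theta n (b v)) /\
  forall j, j < size (theta n (c v)) ->
    (j < size (theta n (a v)) /\ L (c v) j = L (a v) j) \/
    (size (theta n (a v)) < j.+1 /\
     L (c v) j = L (b v) (j - size (theta n (a v)))))) => [v|].
  set x := theta n (c v); set y := theta n (a v); set z := theta n (b v).
  split=> [[xyz Lx]|xyz].
    apply: (inj_map (@letter_code_inj n)); rewrite map_cat.
    apply: (@eq_from_nth _ 0); rewrite ?size_cat ?size_map // => j jx.
    rewrite nth_cat size_map; case: (Lx j jx) => -[jy];
      rewrite /L -/x -/y -/z => ->; first by rewrite jy.
    by rewrite ltnNge -ltnS jy.
  split=> [|j _]; first by rewrite xyz size_cat.
  rewrite /L -/x -/y -/z xyz map_cat nth_cat size_map ltnS.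
  by case: ltnP => jy; [left|right].
have [ra1 rb1 rc1] := And3 (Rec_behead ra) (Rec_behead rb) (Rec_behead rc).
have rh : Rec (fun w => head 0 w) by rec_env.
apply: (CE_and hpair).
  by apply: CE_eq; [apply: rsize|apply: Rec_add; apply: rsize].
apply: (CE_forall_lt hpair); first exact: rsize.
apply: CE_or; apply: (CE_and hpair).
- by apply: CE_lt => //; exact: rsize.
- by apply: CE_eq; apply: rL.
- by apply: CE_lt; [exact: rsize|exact: Rec_succ].
- by apply: CE_eq; apply: rL => //; apply: Rec_sub => //; exact: rsize.
Qed.

(** The search is for a coded chain of insertions and deletions from [r] to the empty word; all
    words are replaced by their codes under [theta n]. *)
Lemma CE_pres_eq n (r : word n) a : 0 < n -> Rec a ->
  CE (fun v => pres_eq (theta n @` W phi (a v)) r [::]).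
Proof.
move=> n0 ra; have [code codeK thetaK] : bijective (theta n).
  by case: htheta => + _ _; exact.
pose cat x y z := theta n z = theta n x ++ theta n y.
pose relator i q := W phi i q \/
  exists2 a, a \in enum (('I_n * bool)%type : finType) &
    q = code [:: a; @inv_letter n a].
(* The extra [z] codes the product of [u] and [q], since [cat] joins only two words. *)
pose ins i x y := exists u q v z,
  [/\ relator i q, cat u v x, cat u q z & cat z v y].
have insP i x y :
    ins i x y <-> insertion (theta n @` W phi i) (theta n x) (theta n y).
  split.
    move=> [u [q [v [z [Rq uvx uqz zvy]]]]].
    exists (theta n u), (theta n q), (theta n v).
    split; rewrite ?zvy ?uqz ?catA //.
    case: Rq => [Wq|[b _ ->]]; first by left; exists q.
    by right; exists b; rewrite thetaK.
  move=> [u [q [v [Rq xE yE]]]].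
  exists (code u), (code q), (code v), (code (u ++ q)).
  split; rewrite /cat ?thetaK // -?catA //.
  case: Rq => [[m Wm <-]|[b ->]]; first by left; rewrite codeK.
  by right; exists b; rewrite ?mem_enum.
apply: (@CE_ext (fun v => exists c k,
  [/\ seq_decode fst snd c 0 = code r, seq_decode fst snd c k = code [::] &
    forall i, i < k ->
      ins (a v) (seq_decode fst snd c i) (seq_decode fst snd c i.+1) \/
      ins (a v) (seq_decode fst snd c i.+1) (seq_decode fst snd c i)])) => [v|].
  rewrite pres_eq_path; split=> [[c [k [c0 ck cins]]]|[p rp pe]].
    pose f i := theta n (seq_decode fst snd c i).
    have rE : r = f 0 by rewrite /f c0 thetaK.
    have fE i : i <= k -> nth [::] (r :: mkseq (fun i => f i.+1) k) i = f i.
      by case: i => [|i] // ik; rewrite /= nth_mkseq.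
    exists (mkseq (fun i => f i.+1) k).
      apply/(pathP [::]) => i; rewrite size_mkseq => ik.
      rewrite fE ?(ltnW ik) // nth_mkseq //.
      by apply/asboolP; rewrite -!insP; exact: cins.
    by rewrite (last_nth [::]) size_mkseq fE // /f ck thetaK.
  (* The chain has one word more than [p], namely its start [r]. *)
  have [c cp] := seq_decode_exists hpair (fun i => code (nth [::] (r :: p) i))
    (size p).+1.
  exists c, (size p); rewrite !cp //; split=> //.
    by rewrite -(last_nth [::]) pe.
  move=> i ip; rewrite !cp ?ltnS //; last exact: ltnW.
  by have /(pathP [::])/(_ i ip)/asboolP := rp; rewrite !insP !thetaK.
have CE_relator i q : Rec i -> Rec q -> CE (fun v => relator (i v) (q v)).
  move=> ri rq; apply: CE_or; first exact: (CE_W hpair hphi).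
  by apply: CE_exists_in => b; apply: CE_eq => //; exact: Rec_const.
have CE_ins i x y : Rec i -> Rec x -> Rec y ->
    CE (fun v => ins (i v) (x v) (y v)).
  move=> ri rx ry; do 4!apply: (CE_exists hpair).
  have weak4 d : Rec d ->
      Rec (fun w => d (behead (behead (behead (behead w))))).
    by move=> rd; exact: Rec_behead (Rec_behead (Rec_behead (Rec_behead rd))).
  have [ri4 rx4 ry4] := And3 (weak4 _ ri) (weak4 _ rx) (weak4 _ ry).
  apply: (@CE_ext (fun w => (relator (i (behead (behead (behead (behead w)))))
    (head 0 (behead (behead w))) /\
    cat (head 0 (behead (behead (behead w)))) (head 0 (behead w))
      (x (behead (behead (behead (behead w)))))) /\
    (cat (head 0 (behead (behead (behead w)))) (head 0 (behead (behead w)))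
      (head 0 w) /\
    cat (head 0 w) (head 0 (behead w)) (y (behead (behead (behead (behead w)))))))).
    by move=> w; split=> [[[? ?] []]|[]].
  apply: (CE_and hpair); apply: (CE_and hpair).
  - by apply: CE_relator => //; rec_env.
  - by apply: CE_theta_cat => //; rec_env.
  - by apply: CE_theta_cat => //; rec_env.
  - by apply: CE_theta_cat => //; rec_env.
do 2!apply: (CE_exists hpair); apply: (CE_and3 hpair).
- by apply: CE_eq; [apply: (Rec_seq_decode hpair)|]; rec_env.
- by apply: CE_eq; [apply: (Rec_seq_decode hpair)|]; rec_env.
apply: (CE_forall_lt hpair); first by rec_env.
have ra3 : Rec (fun w => a (behead (behead (behead w)))).
  by exact: Rec_behead (Rec_behead (Rec_behead ra)).
by apply: CE_or; apply: CE_ins => //; apply: (Rec_seq_decode hpair); rec_env.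
Qed.
End WordProblem.

(** * Semi-decidable sets *)

Section SemidecidableSets.
Variables (pair : nat -> nat -> nat) (fst snd : nat -> nat).
Hypothesis hpair : computable_pairing pair fst snd.
Variable theta : forall n : nat, nat -> word n.
Hypothesis htheta : computable_words theta.
Variable phi : nat -> nat -> option nat.
Hypothesis hphi : standard_enumeration phi.

Let fstK n m : fst (pair n m) = n. Proof. by case: hpair => _ _ _ []. Qed.
Let sndK n m : snd (pair n m) = m. Proof. by case: hpair => _ _ _ []. Qed.

Let nu := nuRP fst snd theta phi.

(** The test checks that the rank is [n], then searches for derivations of the finitely many
    relators in [s]. *)
Lemma semidecidable_above n (s : seq (word n)) : 0 < n ->
  semidecidable
    [set x : GRP fst snd theta phi | (pres [set` s] <= set_val x)%O].
Proof.
move=> n0.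
have r1 : Rec (fun v => snd (head 0 v)) by apply: (Rec_snd hpair); rec_env.
have cP : CE (fun v => fst (head 0 v) = n /\ forall r, r \in s ->
    pres_eq (theta n @` W phi (snd (head 0 v))) r [::]).
  apply: (CE_and hpair).
    by apply: CE_eq; [apply: (Rec_fst hpair)|]; rec_env.
  by apply: (CE_forall_in hpair) => r; exact: (CE_pres_eq hpair htheta hphi).
have [F cF FP] := CE_partial_computable1 cP.
exists F => // p p0; rewrite FP /=.
apply: (@iff_trans _ (pres [set` s] <= nu p)%O); last first.
  split=> [sp|[x /= sx xp]]; last by rewrite /nu -xp.
  have Gp : nu p \in GRP fst snd theta phi by apply/mem_set; exists p.
  by exists (SigSub Gp).
split=> [[pn sp]|sp]; first by subst n; exact/pres_le.
by have pn := pres_le_rank sp; subst n; split=> //; exact/pres_le.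
Qed.

(** * The Rice-Shapiro argument *)

Variable A : set (GRP fst snd theta phi).
Hypothesis sA : semidecidable A.

Let B : set markedClass := set_val @` A.

(** If the conclusion failed, [R e] would present an element of [A] exactly when [e] is outside the
    halting set; running [F] on the index [pair n (s e)] would then enumerate the complement. *)
Lemma semidecidable_switch n P :
  let R e := theta n @` [set m | P [:: e; m]] in
  0 < n -> CE P -> (forall e, ~ W phi e e -> B (pres (R e))) ->
  exists2 e, W phi e e & B (pres (R e)).
Proof.
move=> R n0 cP BR; apply: contrapT => nB.
have [s cs sP] := W_parametrization hphi cP.
have [F cF FA] := sA.
have FB e : F (pair n (s e)) <-> B (pres (R e)).
  rewrite FA /dom_nuRP /= ?fstK //.
  suff -> : nuRP fst snd theta phi (pair n (s e)) = pres (R e) by [].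
  rewrite /nuRP fstK sndK; congr (pres _); congr image.
  by apply/seteqP; split=> m /sP.
apply: (not_CE_diagonal hphi).
apply: (@CE_ext (fun v => F (pair n (s (head 0 v))))) => [v|].
  rewrite FB; split=> [Be|]; last exact: BR.
  by move=> We; apply: nB; exists (head 0 v).
apply: (CE_partial_computable1_dom hpair cF).
have [cpair _ _ _] := hpair.
by apply: (Rec_fun2 cpair); [|apply: (Rec_fun1 cs)]; rec_env.
Qed.

Lemma semidecidable_upper n n' i j : 0 < n ->
  let R n i := theta n @` W phi i in
  B (pres (R n i)) -> (pres (R n i) <= pres (R n' j))%O -> B (pres (R n' j)).
Proof.
move=> n0 R Bi ij; have nn' := pres_le_rank ij; subst n'.
(* The relators of [i] are always listed, those of [j] only once [e] halts. For halting [e] the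
   union presents the same group as [j] alone, because the relators of [i] already hold there. *)
pose P v := W phi i (nth 0 v 1) \/
  (W phi j (nth 0 v 1) /\ W phi (head 0 v) (head 0 v)).
have cP : CE P.
  apply: CE_or; first by apply: (CE_W hpair hphi); rec_env.
  by apply: (CE_and hpair); apply: (CE_W hpair hphi); rec_env.
have [e We] : exists2 e, W phi e e &
    B (pres (theta n @` [set m | P [:: e; m]])).
  apply: semidecidable_switch => // e nWe.
  suff -> : [set m | P [:: e; m]] = W phi i by [].
  by apply/seteqP; split=> m; rewrite /P /=; [case=> // -[]|left].
suff -> : pres (theta n @` [set m | P [:: e; m]]) = pres (R n j) by [].
apply: Order.le_anti; apply/andP; split; apply/pres_le => r [m].
  case=> /= [Wi|[Wj _]] <-; last by apply: pres_relator; exists m.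
  by have /pres_le := ij; apply; exists m.
by move=> Wj <-; apply: pres_relator; exists m => //; right.
Qed.

Lemma semidecidable_finitary n i : 0 < n ->
  let R := theta n @` W phi i in
  B (pres R) ->
  exists2 s : seq (word n), [set` s] `<=` R & B (pres [set` s]).
Proof.
move=> n0 R BR.
have [D rD DW] := CE_W hpair hphi (Rec_const i) Rec_head.
have [K rK KW] := CE_W hpair hphi Rec_head Rec_head.
(* m is enumerated at stage t while e has not entered the halting set by stage
   t + m; adding m makes the set finite once e has entered. *)
pose P v := exists t, D [:: t; nth 0 v 1] = 0 /\
  forall u, u < t + nth 0 v 1 -> 0 < K [:: u; head 0 v].
have cP : CE P.
  have r1 : Rec (fun w => nth 0 (behead w) 1).
    exact: Rec_behead (Rec_nth 1).
  apply: (CE_exists hpair); apply: (CE_and hpair).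
    apply: CE_eq; last exact: Rec_const.
    apply: (Rec_comp rD (e := fun w => [:: head 0 w; nth 0 (behead w) 1])).
    by rec_env.
  apply: (CE_forall_lt hpair); first by rec_env.
  apply: CE_lt; first exact: Rec_const.
  apply: (Rec_comp rK (e := fun w => [:: head 0 w; head 0 (behead (behead w))])).
  by rec_env.
have PW e m : P [:: e; m] -> W phi i m.
  by move=> [t [Dt _]]; apply/(DW [:: m]); exists t.
have [e We Be] : exists2 e, W phi e e &
    B (pres (theta n @` [set m | P [:: e; m]])).
  apply: semidecidable_switch => // e nWe.
  suff -> : [set m | P [:: e; m]] = W phi i by [].
  apply/seteqP; split=> m; first exact: PW.
  move=> /(DW [:: m])[t Dt]; exists t; split=> // u _.
  by rewrite lt0n; apply/eqP => Ku; apply: nWe; apply/(KW [:: e]); exists u.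
have [t0 Kt0] := (KW [:: e]).1 We.
have Pt0 m : P [:: e; m] -> m < t0.+1.
  move=> [t [_ Ku]]; rewrite ltnS leqNgt; apply/negP => t0m.
  by have := Ku t0; rewrite Kt0 => /(_ (ltn_addl t t0m)).
pose s := [seq theta n m | m <- iota 0 t0.+1 & `[< P [:: e; m] >]].
have sE : [set` s] = theta n @` [set m | P [:: e; m]].
  apply/seteqP; split=> w /=.
    by move=> /mapP[m]; rewrite mem_filter => /andP[/asboolP Pm _] ->; exists m.
  move=> [m Pm <-]; apply/map_f; rewrite mem_filter mem_iota Pt0 // leq0n !andbT.
  by apply/asboolP.
exists s; last by rewrite sE.
by rewrite sE => _ [m /PW Wm <-]; exists m.
Qed.

(** The open set is the union of the up-sets of the finitely presented members of [A]. Finitariness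
    shows that its trace contains [A], upward closure that it is contained in [A]. *)
Lemma semidecidable_scott_open :
  exists2 O : set markedClass, scott_open O & set_val @^-1` O = A.
Proof.
pose I := {n & seq (word n)}.
pose f (j : {j : I | B (pres [set` projT2 j])}) : set markedClass :=
  [set x | (pres [set` projT2 (proj1_sig j)] <= x)%O].
exists (\bigcup_j f j).
  by apply: scott_open_bigU => j; exact: scott_open_above_finitely_presented.
have BA x : B (set_val x) -> A x by move=> [y Ay /val_inj <-].
apply/seteqP; split=> x.
  move=> [[[n s] /= Bs] _]; rewrite /f /= => sx; apply: BA.
  have [y Ay ys] := Bs.
  (* Upward closure is stated for enumerated presentations, hence the passage to indices of both
     points. *)
  have [[q q0 qy] [p _ px]] := (set_valP y, set_valP x).
  have qx : (nu q <= nu p)%O by rewrite [nu q](etrans qy ys) [nu p]px.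
  suff : B (nu p) by rewrite [nu p]px.
  by apply: (semidecidable_upper q0 _ qx); exists y.
move=> Ax; have [p p0 px] := set_valP x.
have Bp : B (nu p) by exists x.
have [s sR Bs] := semidecidable_finitary p0 Bp.
exists (exist _ (existT _ (fst p) s) Bs) => //.
have sp : (pres [set` s] <= nu p)%O.
  by apply/pres_le => r /sR; exact: pres_relator.
by rewrite [nu p]px in sp.
Qed.

End SemidecidableSets.

(** * Comparison of the two topologies *)

Theorem corollary30 (pair : nat -> nat -> nat) (fst snd : nat -> nat)
  (theta : forall n : nat, nat -> word n) (phi : nat -> nat -> option nat)
  (hpair : computable_pairing pair fst snd)
  (htheta : computable_words theta)
  (hphi : standard_enumeration phi) :
  forall U : set (GRP fst snd theta phi),
    @open (GRP_semidec fst snd theta phi) U <->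
    @open (set_type (GRP fst snd theta phi)) U.
Proof.
move=> U; split.
  (* An open set of the generated topology is a union of finite intersections of semi-decidable
     sets; each such intersection is shown to be a neighbourhood of its points. *)
  move=> [D' sD' <-]; apply: bigcup_open => V /sD' [D sD <-].
  rewrite openE => x Dx; apply: filter_bigI => V' V'D.
  have sV : semidecidable V' by have := sD _ V'D; rewrite inE.
  have [O oO OV] := semidecidable_scott_open hpair hphi sV.
  apply: open_nbhs_nbhs; split; last exact: Dx.
  by exists O.
move=> [O oO <-].
(* The trace of [O] is the union of the semi-decidable sets inside it: a point is covered by the
   up-set of a finite sub-presentation still in [O], which stays in [O] because [O] is an upper
   set. *)
pose D' := [set V : set (GRP fst snd theta phi) |
  semidecidable V /\ V `<=` set_val @^-1` O].
exists D'; first by move=> V [sV _]; apply: finI_from1.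
apply/seteqP; split=> x; first by move=> [V [_ +]]; apply.
move=> Ox; have [p p0 px] := set_valP x.
have [s sR Os] : exists2 s : seq (word (fst p)),
    [set` s] `<=` theta (fst p) @` W phi (snd p) & O (pres [set` s]).
  apply: scott_open_finite_subpresentation => //.
  by have := Ox; rewrite /= -[set_val x]px.
exists [set y : GRP fst snd theta phi | (pres [set` s] <= set_val y)%O].
  split; first exact: (semidecidable_above hpair htheta hphi).
  by move=> y; exact: oO.1.
have sp : (pres [set` s] <= nuRP fst snd theta phi p)%O.
  by apply/pres_le => r /sR; exact: pres_relator.
by rewrite px in sp.
Qed.
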